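(* Let $\{G_n\}_{n\ge 0}$ be a Gibonacci sequence. For all integers $n\geq 2$, both of the following hold: $$(G_1-G_0)\sum_{j=1}^{n-1}G_{2n-1-2j}+G_0\sum_{j=1}^{n-1}jG_{2n-1-2j}+2G_0G_1+G_0^2(n-2)=G_1G_{2n-2}+G_0G_{2n-3},$$ and $$(G_1-G_0)\sum_{j=1}^{n-1}G_{2n-2j}+G_0\sum_{j=1}^{n-1}jG_{2n-2j}+G_0^2+\bigl(G_1+(n-1)G_0\bigr)G_1=G_1G_{2n-1}+G_0G_{2n-2}.$$
   Context: A Gibonacci sequence is a sequence satisfying $G_n=G_{n-1}+G_{n-2}$ for $n\ge 2$, with initial values $G_0,G_1$ chosen freely (here arbitrary integers). *)

(* Defs.v *)
From mathcomp Require Import all_boot all_order all_algebra.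

Set Implicit Arguments.
Unset Strict Implicit.
Unset Printing Implicit Defensive.

Import GRing.Theory.
Local Open Scope ring_scope.

Definition gibonacci (G : nat -> int) : Prop :=
  forall n : nat, (2 <= n)%N -> G n = G (n - 1)%N + G (n - 2)%N.

(* Main.v *)
Require Import Defs.
From mathcomp Require Import all_boot all_order all_algebra.
From mathcomp Require Import zify ring.

Set Implicit Arguments.
Unset Strict Implicit.
Unset Printing Implicit Defensive.

Import GRing.Theory.
Local Open Scope ring_scope.

(** Both sums run downwards in steps of two and end at [G b.+1], with [b = 0]
    in the first identity and [b = 1] in the second.  Since
    [G i.+1 = G i.+2 - G i], the plain sum telescopes ([sum_every_other]); the
    weighted sum is a sum of such partial sums, hence telescopes a second time
    ([weighted_sum_every_other]).  With [m = n - 1] the closed forms give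
<<
  (G 1 - G 0) (G (b + 2 m) - G b)
    + G 0 (G (b + 2 m + 1) - G (b + 1) - m G b),
>>
    and [G (b + 2 m + 1) - G (b + 2 m) = G (b + 2 m - 1)] turns its
    non-constant part into the right-hand side of the identity; what remains
    cancels against the terms in [G 0], [G 1] and [n] added to the sums. *)

Lemma gibonacciSS (G : nat -> int) (hG : gibonacci G) (i : nat) :
  G i.+2 = G i.+1 + G i.
Proof. by rewrite hG // subSS subn0 subSS subn1. Qed.

Lemma sum_every_other (G : nat -> int) (hG : gibonacci G) (b m : nat) :
  \sum_(1 <= j < m.+1) G ((b + 2 * m).+1 - 2 * j)%N = G (b + 2 * m)%N - G b.
Proof.
elim: m => [|m IHm]; first by rewrite big_geq // muln0 addn0 subrr.
rewrite big_nat_recl //=.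
under eq_bigr => j _ do
  have -> : ((b + 2 * m.+1).+1 - 2 * j.+1 = (b + 2 * m).+1 - 2 * j)%N by lia.
rewrite IHm (_ : ((b + 2 * m.+1).+1 - 2 * 1 = (b + 2 * m).+1)%N); last by lia.
rewrite (_ : (b + 2 * m.+1 = (b + 2 * m).+2)%N); last by lia.
by rewrite (gibonacciSS hG) addrA.
Qed.

(** Raising [m] by one adds one to every weight, that is, adds one more plain
    sum; so the weighted sum is the sum over [i <= m] of the closed forms
    [G (b + 2 i) - G b], whose first terms telescope again. *)
Lemma weighted_sum_every_other (G : nat -> int) (hG : gibonacci G) (b m : nat) :
  \sum_(1 <= j < m.+1) j%:Z * G ((b + 2 * m).+1 - 2 * j)%N
  = G (b + 2 * m).+1 - G b.+1 - m%:Z * G b.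
Proof.
elim: m => [|m IHm]; first by rewrite big_geq // muln0 addn0; ring.
rewrite big_nat_recl //=.
under eq_bigr => j _ do
  have -> : ((b + 2 * m.+1).+1 - 2 * j.+1 = (b + 2 * m).+1 - 2 * j)%N by lia.
under eq_bigr => j _ do rewrite intS mulrDl mul1r.
rewrite big_split /= IHm (sum_every_other hG).
rewrite (_ : ((b + 2 * m.+1).+1 - 2 * 1 = (b + 2 * m).+1)%N); last by lia.
rewrite (_ : ((b + 2 * m.+1).+1 = (b + 2 * m).+3)%N); last by lia.
by rewrite !(gibonacciSS hG) intS; ring.
Qed.

Theorem mainTheorem3 (G : nat -> int) (hG : gibonacci G)
    (n : nat) (hn : (2 <= n)%N) :
  (G 1%N - G 0%N) * (\sum_(1 <= j < n) G (2 * n - 1 - 2 * j)%N)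
    + G 0%N * (\sum_(1 <= j < n) j%:Z * G (2 * n - 1 - 2 * j)%N)
    + 2 * G 0%N * G 1%N + G 0%N ^+ 2 * (n%:Z - 2)
  = G 1%N * G (2 * n - 2)%N + G 0%N * G (2 * n - 3)%N
  /\
  (G 1%N - G 0%N) * (\sum_(1 <= j < n) G (2 * n - 2 * j)%N)
    + G 0%N * (\sum_(1 <= j < n) j%:Z * G (2 * n - 2 * j)%N)
    + G 0%N ^+ 2 + (G 1%N + (n%:Z - 1) * G 0%N) * G 1%N
  = G 1%N * G (2 * n - 1)%N + G 0%N * G (2 * n - 2)%N.
Proof.
(* Writing [n = k + 2] makes every index on the right an explicit successor;
   the sums then have [m = k + 1] terms. *)
case: n hn => [|[|k]] // _.
split.
- under eq_bigr => j _ do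
    have -> : (2 * k.+2 - 1 - 2 * j = (0 + 2 * k.+1).+1 - 2 * j)%N by lia.
  under [X in G 0%N * X]eq_bigr => j _ do
    have -> : (2 * k.+2 - 1 - 2 * j = (0 + 2 * k.+1).+1 - 2 * j)%N by lia.
  rewrite (sum_every_other hG) (weighted_sum_every_other hG).
  rewrite (_ : (0 + 2 * k.+1 = (2 * k).+2)%N); last by lia.
  rewrite (_ : (2 * k.+2 - 2 = (2 * k).+2)%N); last by lia.
  rewrite (_ : (2 * k.+2 - 3 = (2 * k).+1)%N); last by lia.
  by rewrite !(gibonacciSS hG) !intS; ring.
- under eq_bigr => j _ do
    have -> : (2 * k.+2 - 2 * j = (1 + 2 * k.+1).+1 - 2 * j)%N by lia.
  under [X in G 0%N * X]eq_bigr => j _ do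
    have -> : (2 * k.+2 - 2 * j = (1 + 2 * k.+1).+1 - 2 * j)%N by lia.
  rewrite (sum_every_other hG) (weighted_sum_every_other hG).
  rewrite (_ : (1 + 2 * k.+1 = (2 * k).+3)%N); last by lia.
  rewrite (_ : (2 * k.+2 - 1 = (2 * k).+3)%N); last by lia.
  rewrite (_ : (2 * k.+2 - 2 = (2 * k).+2)%N); last by lia.
  by rewrite !(gibonacciSS hG) !intS; ring.
Qed.
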